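(* Scheduling the jobs in non-decreasing processing time order is a 2-approximation algorithm for $1|nr=1, a_j=\bar a|\sum C_j$. That is, for every instance of single machine scheduling with one non-renewable resource (with an arbitrary number $q$ of supplies) in which all jobs have the same resource requirement $a_j=\bar a$, list scheduling the jobs in non-decreasing order of $p_j$ is a polynomial time algorithm producing a feasible schedule whose total completion time $\sum_j C_j$ is at most $2\cdot OPT$, where $OPT$ is the minimum of $\sum_j C_j$ over all feasible schedules.
   Context: Scheduling model. A finite set $\mathcal{J}$ of $n$ jobs is to be processed without preemption on a single machine that processes at most one job at a time. Job $j$ has processing time $p_j>0$ and resource requirement $a_j\ge 0$ from a single non-renewable resource. The resource is supplied at $q\ge1$ known time points $0=u_1<u_2<\dots<u_q$, in quantities $\tilde b_1,\dots,\tilde b_q>0$. A schedule assigns a start time $S_j\ge 0$ to each job; job $j$ occupies the machine during $[S_j,S_j+p_j)$, and its completion time is $C_j=S_j+p_j$. A schedule is feasible if the jobs do not overlap on the machine and, for every time $t\ge0$, $\sum_{j: S_j\le t} a_j\le\sum_{\ell: u_\ell\le t}\tilde b_\ell$. It is assumed that the total requirement equals the total supply, $\sum_{j}a_j=\sum_{\ell=1}^q\tilde b_\ell$. The numerical data are rational numbers encoded in binary, with each job listed individually in the input. List scheduling in a given job order: the jobs are processed in exactly that order (ties in the order broken arbitrarily), each job being started as early as possible, i.e., at the earliest time that is not before the completion time of the preceding job in the order and at which the total supply received so far is at least the total requirement of this job and all jobs preceding it in the order (so a gap is introduced only if not enough resource is available for the next job). *)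

(* Defs.v *)
From mathcomp Require Import all_boot all_order all_algebra perm.
From mathcomp Require Import reals.

Set Implicit Arguments.
Unset Strict Implicit.
Unset Printing Implicit Defensive.

Import Order.TTheory GRing.Theory Num.Theory.

Local Open Scope ring_scope.

(* The data of an instance are rational; start times are real. *)
Record instance := Instance {
  njobs : nat;
  nsupp : nat;
  ptime : 'I_njobs -> rat;
  req : 'I_njobs -> rat;
  sdate : 'I_nsupp -> rat;
  sqty : 'I_nsupp -> rat
}.

Record valid_instance (I : instance) : Prop := ValidInstance {
  ptime_gt0 : forall j, 0 < ptime (i := I) j;
  req_ge0 : forall j, 0 <= req (i := I) j;
  nsupp_gt0 : (0 < nsupp I)%N;
  sdate_first : forall l : 'I_(nsupp I), val l = 0%N -> sdate l = 0;
  sdate_incr : forall l m : 'I_(nsupp I), (l < m)%N -> sdate l < sdate m;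
  sqty_gt0 : forall l, 0 < sqty (i := I) l;
  req_total : \sum_(j < njobs I) req j = \sum_(l < nsupp I) sqty l
}.

Definition equal_requirements (I : instance) : Prop :=
  exists abar : rat, forall j, req (i := I) j = abar.

Section Schedules.
Variables (R : realType) (I : instance).

Definition schedule := 'I_(njobs I) -> R.

Definition completion (S : schedule) (j : 'I_(njobs I)) : R :=
  S j + ratr (ptime j).

Definition occupies (S : schedule) (j : 'I_(njobs I)) (t : R) : Prop :=
  S j <= t < completion S j.

Definition supplied (t : R) : R :=
  \sum_(l < nsupp I | ratr (sdate l) <= t) ratr (sqty l).

Record feasible (S : schedule) : Prop := Feasible {
  start_ge0 : forall j, 0 <= S j;
  one_at_a_time : forall (t : R) i j, occupies S i t -> occupies S j t -> i = j;
  enough_supply : forall t : R, 0 <= t ->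
    \sum_(j < njobs I | S j <= t) ratr (req j) <= supplied t
}.

Definition total_completion (S : schedule) : R :=
  \sum_(j < njobs I) completion S j.

Definition least (P : R -> Prop) (x : R) : Prop :=
  P x /\ forall y, P y -> x <= y.

Definition optimum : R -> Prop :=
  least (fun v => exists2 S, feasible S & v = total_completion S).

(* A job order is a permutation [s]: [s k] is the job in position [k]. *)
Definition can_start (s : {perm 'I_(njobs I)}) (S : schedule)
    (k : 'I_(njobs I)) (t : R) : Prop :=
  [/\ 0 <= t,
      forall k' : 'I_(njobs I), k'.+1 = k :> nat -> completion S (s k') <= t
    & \sum_(i < njobs I | (i <= k)%N) ratr (req (s i)) <= supplied t].

Definition list_schedule (s : {perm 'I_(njobs I)}) (S : schedule) : Prop :=
  forall k, least (can_start s S k) (S (s k)).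

End Schedules.

Definition nondecreasing_ptime (I : instance) (s : {perm 'I_(njobs I)}) : Prop :=
  forall i k : 'I_(njobs I), (i <= k)%N -> ptime (s i) <= ptime (s k).

(* Polynomial time is measured on a structured random access machine with
   logarithmic cost.  The memory consists of arrays of natural numbers, of which
   a program uses only finitely many since array names are constants; every
   operation is charged the bit lengths of the addresses and values it handles
   (the product of the bit lengths for a multiplication). *)
Section Machine.
Local Open Scope nat_scope.

Definition bitlen (n : nat) : nat := (trunc_log 2 n).+1.

Definition memory := nat -> nat -> nat.

Inductive expr :=
| Cst of nat
| Get of nat & expr
| Add of expr & expr
| Sub of expr & expr
| Mul of expr & expr.

Fixpoint eval (m : memory) (e : expr) : nat :=
  match e with
  | Cst n => n
  | Get a e1 => m a (eval m e1)
  | Add e1 e2 => eval m e1 + eval m e2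
  | Sub e1 e2 => eval m e1 - eval m e2
  | Mul e1 e2 => eval m e1 * eval m e2
  end.

Fixpoint ecost (m : memory) (e : expr) : nat :=
  match e with
  | Cst n => bitlen n
  | Get a e1 => ecost m e1 + bitlen (eval m e1) + bitlen (eval m e)
  | Add e1 e2 | Sub e1 e2 =>
      ecost m e1 + ecost m e2 + bitlen (eval m e1) + bitlen (eval m e2)
  | Mul e1 e2 =>
      ecost m e1 + ecost m e2 + bitlen (eval m e1) * bitlen (eval m e2)
  end.

Inductive cmd :=
| Skip
| Put of nat & expr & expr
| Seq of cmd & cmd
| If of expr & cmd & cmd
| While of expr & cmd.

Definition update (m : memory) (a i v : nat) : memory :=
  fun a' i' => if (a' == a) && (i' == i) then v else m a' i'.

(* [exec c m m' t]: run from [m], the program [c] halts in [m'] at cost [t]. *)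
Inductive exec : cmd -> memory -> memory -> nat -> Prop :=
| ExecSkip m : exec Skip m m 1
| ExecPut a e1 e2 m :
    exec (Put a e1 e2) m (update m a (eval m e1) (eval m e2))
      (ecost m e1 + ecost m e2 + bitlen (eval m e1) + bitlen (eval m e2))
| ExecSeq c1 c2 m m1 m2 t1 t2 :
    exec c1 m m1 t1 -> exec c2 m1 m2 t2 -> exec (Seq c1 c2) m m2 (t1 + t2)
| ExecIfTrue e c1 c2 m m1 t :
    eval m e != 0 -> exec c1 m m1 t -> exec (If e c1 c2) m m1 (ecost m e + t)
| ExecIfFalse e c1 c2 m m1 t :
    eval m e = 0 -> exec c2 m m1 t -> exec (If e c1 c2) m m1 (ecost m e + t)
| ExecWhileTrue e c m m1 m2 t1 t2 :
    eval m e != 0 -> exec c m m1 t1 -> exec (While e c) m1 m2 t2 ->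
    exec (While e c) m m2 (ecost m e + t1 + t2)
| ExecWhileFalse e c m :
    eval m e = 0 -> exec (While e c) m m (ecost m e).

(* The input word is stored in array 0; all other cells contain 0. *)
Definition initial (w : seq nat) : memory :=
  fun a i => if a == 0 then nth 0 w i else 0.

Definition input_size (w : seq nat) : nat := \sum_(x <- w) bitlen x.

Definition polynomial_time_computable (A : Type) (D : A -> Prop)
    (enc : A -> seq nat) (spec : A -> memory -> Prop) : Prop :=
  exists (c : cmd) (k d : nat), forall x : A, D x ->
    exists (m : memory) (t : nat),
      [/\ exec c (initial (enc x)) m t,
          t <= k * input_size (enc x) ^ d
        & spec x m].

End Machine.

(* The data are nonnegative rationals, so numerators need no sign. *)
Definition encode_rat (x : rat) : seq nat := [:: `|numq x|%N; `|denq x|%N].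

Definition encode_family (n : nat) (x : 'I_n -> rat) : seq nat :=
  flatten [seq encode_rat (x i) | i <- enum 'I_n].

Definition encode (I : instance) : seq nat :=
  [:: njobs I, nsupp I &
    encode_family (ptime (i := I)) ++ encode_family (req (i := I)) ++
    encode_family (sdate (i := I)) ++ encode_family (sqty (i := I))].

(* The output is read from array 1: cells [2j] and [2j+1] hold the numerator and
   the denominator of the start time of job [j], as a fraction that need not be
   in lowest terms. *)
Definition outputs (R : realType) (I : instance) (m : memory)
    (S : schedule R I) : Prop :=
  forall j : 'I_(njobs I),
    m 1%N j.*2.+1 != 0%N /\ S j = (m 1%N j.*2)%:R / (m 1%N j.*2.+1)%:R.

(* Main.v *)
Require Import Defs.
From mathcomp Require Import all_boot all_order all_algebra perm.
From mathcomp Require Import reals.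
From mathcomp Require Import zify ring lra.

(* In the order of non-decreasing processing times, let [P k] be the work placed
   before position [k].  When all requirements are equal, the job in position [k]
   of any order needs the same prefix supply, so by induction list scheduling
   starts it no later than [S' k + P k], where [S' k] is the start in position [k]
   of an arbitrary feasible schedule.  Including the job itself, this work is at
   most the completion time in position [k] of the feasible schedule, so every
   position loses at most a factor 2.  An optimum exists because list scheduling
   along the start order of a feasible schedule does not delay any job, which
   leaves finitely many candidates.

   The program computes ranks by pairwise comparison and then runs list
   scheduling with unreduced fractions.  The current time is either an input date
   or the previous time plus one processing time, so numerator and denominator
   are bounded by a product of linearly many input numbers, and every operation
   handles numbers of at most quadratic bit length. *)

Set Implicit Arguments.
Unset Strict Implicit.
Unset Printing Implicit Defensive.

Import Order.TTheory GRing.Theory Num.Theory.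

Local Open Scope ring_scope.

(** * Orders and schedules *)

Section Rank.
Variables (n : nat) (lt : rel 'I_n).

Definition rank (j : 'I_n) : nat := #|[pred i | lt i j]|.

Hypothesis lt_irr : irreflexive lt.
Hypothesis lt_trans : transitive lt.
Hypothesis lt_total : forall i j, i != j -> lt i j || lt j i.

Lemma rank_mono i j : lt i j -> (rank i < rank j)%N.
Proof.
move=> ltij; apply/proper_card/properP; split.
  by apply/subsetP => k; rewrite !inE => ltki; exact: lt_trans ltki ltij.
by exists i; rewrite !inE ?lt_irr.
Qed.

(** For a strict total order, [rank] is an injection into ['I_n], hence a permutation; its inverse
    lists the elements in increasing order. *)
Lemma rank_perm : exists s : {perm 'I_n},
  (forall k, rank (s k) = k) /\ (forall i k : 'I_n, (i < k)%N -> lt (s i) (s k)).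
Proof.
have rank_bound j : (rank j < n)%N.
  rewrite -[X in (_ < X)%N]card_ord; apply/proper_card/properP; split.
    exact/subsetP.
  by exists j; rewrite // !inE lt_irr.
have rank_inj : injective (fun j => Ordinal (rank_bound j)).
  move=> i j [eq_rank]; apply/eqP; apply/negPn/negP => /lt_total /orP[] /rank_mono;
  by rewrite eq_rank ltnn.
have rankK k : rank ((perm rank_inj)^-1%g k) = k.
  have: perm rank_inj ((perm rank_inj)^-1%g k) = k by rewrite permKV.
  by rewrite permE => /(congr1 val).
exists (perm rank_inj)^-1%g; split=> // i k ltik.
have /lt_total /orP[//|/rank_mono] :
    ((perm rank_inj)^-1%g i) != ((perm rank_inj)^-1%g k).
  by rewrite (inj_eq perm_inj) neq_ltn ltik.
by rewrite !rankK ltnNge ltnW.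
Qed.

End Rank.

(** * Feasible schedules and the factor 2 *)

Section Feasibility.
Variables (R : realType) (I : instance).
Hypothesis I_valid : valid_instance I.

Local Notation n := (njobs I).
Local Notation job := 'I_n.

Lemma supplied_mono : {homo @supplied R I : t t' / t <= t'}.
Proof.
move=> t t' le_tt'; rewrite /supplied big_mkcond [leRHS]big_mkcond.
apply: ler_sum => l _; case: ifP => [le_lt|_].
  by rewrite (le_trans le_lt le_tt').
by case: ifP => // _; rewrite ler0q ltW ?(sqty_gt0 I_valid).
Qed.

Lemma supplied_ge0 t : 0 <= @supplied R I t.
Proof. by apply: sumr_ge0 => l _; rewrite ler0q ltW ?(sqty_gt0 I_valid). Qed.

Lemma ptime_pos j : 0 < ratr (ptime (i := I) j) :> R.
Proof. by rewrite ltr0q (ptime_gt0 I_valid). Qed.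

(** Let [k] be the last position started by time [t]. All jobs started by then lie in positions up
    to [k], and the requirement of that prefix was already covered at time [S (s k)]. *)
Lemma requirement_le_supplied (S : schedule R I) (s : {perm job}) :
    (forall k, can_start s S k (S (s k))) ->
    {homo (fun k => S (s k)) : i k / (i < k)%N >-> i < k} ->
  forall t, \sum_(j < n | S j <= t) ratr (req j) <= supplied I t.
Proof.
move=> startable incr t; rewrite (reindex_inj (@perm_inj _ s)) /=.
have [k0 Sk0|none] := pickP (fun k => S (s k) <= t); last first.
  by rewrite big_pred0 ?supplied_ge0.
case: (@arg_maxnP _ k0 (fun k => S (s k) <= t) val Sk0) => k Sk k_max.
have [_ _ enough] := startable k.
apply: le_trans (supplied_mono Sk); apply: le_trans enough.
rewrite big_mkcond [leRHS]big_mkcond; apply: ler_sum => i _.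
case: ifP => [Si|_]; first by rewrite (k_max i Si : (i <= k)%N).
by case: ifP => // _; rewrite ler0q (req_ge0 I_valid).
Qed.

(** [can_start] constrains only the immediate predecessor; induction on [k] carries the bound to
    every earlier position. *)
Lemma list_schedule_seq (s : {perm job}) (S : schedule R I) (i k : job) :
  list_schedule s S -> (i < k)%N -> completion S (s i) <= S (s k).
Proof.
move=> listS; have [m] := ubnP k; elim: m k => // m IHm k lekm ltik.
have [[_ prev _] _] := listS k.
have lt_k1 : (k.-1 < n)%N by apply: leq_ltn_trans (ltn_ord k); lia.
have := prev (Ordinal lt_k1) (ltn_predK ltik).
have [eq_i|neq_i] := eqVneq i (Ordinal lt_k1); first by rewrite eq_i.
apply: le_trans; apply: le_trans (IHm (Ordinal lt_k1) _ _) _ => /=; first lia.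
  by move: neq_i; rewrite -val_eqE /=; lia.
by rewrite lerDl ltW ?ptime_pos.
Qed.

Lemma list_schedule_incr (s : {perm job}) (S : schedule R I) :
  list_schedule s S ->
  {homo (fun k => S (s k)) : i k / (i < k)%N >-> i < k}.
Proof.
move=> listS i k /(list_schedule_seq listS); apply: lt_le_trans.
by rewrite ltrDl ptime_pos.
Qed.

Lemma list_schedule_feasible (s : {perm job}) (S : schedule R I) :
  list_schedule s S -> feasible S.
Proof.
move=> listS; split=> [j|t i j|t _].
- by have [[]] := listS (s^-1%g j); rewrite permKV.
- rewrite -[i](permKV s) -[j](permKV s).
  move: (s^-1%g i) (s^-1%g j) => {}i {}j /andP[Si Ci] /andP[Sj Cj].
  congr (s _); apply/eqP/negPn; rewrite neq_ltn; apply/negP.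
  by case/orP=> /(list_schedule_seq listS) C_le; move: Si Ci Sj Cj; lra.
- apply: requirement_le_supplied (list_schedule_incr listS) _.
  by move=> k; have [] := listS k.
Qed.

Lemma feasible_seq (S : schedule R I) i j :
  feasible S -> S i < S j -> completion S i <= S j.
Proof.
move=> feasS ltij; rewrite leNgt; apply/negP => Sj_lt.
suff eq_ij : i = j by rewrite eq_ij ltxx in ltij.
apply: (@one_at_a_time _ _ _ feasS (S j)); rewrite /occupies ?(ltW ltij) ?Sj_lt //.
by rewrite lexx ltrDl ptime_pos.
Qed.

(** Processing times are positive, so two jobs with equal start times would both occupy that
    instant. Start times are therefore distinct and order the jobs strictly. *)
Lemma feasible_sorted (S : schedule R I) : feasible S ->
  exists s : {perm job}, {homo (fun k => S (s k)) : i k / (i < k)%N >-> i < k}.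
Proof.
move=> feasS; have [|||s [_ incr]] := @rank_perm n (fun i j => S i < S j).
- by move=> i; rewrite ltxx.
- by move=> j i k; exact: lt_trans.
- move=> i j; rewrite -neq_lt; apply: contra_neq => eqS.
  apply: (@one_at_a_time _ _ _ feasS (S i));
    by rewrite /occupies /completion -?eqS lexx ltrDl ptime_pos.
by exists s.
Qed.

(** Lets the start times of a feasible schedule compete with the least admissible time that list
    scheduling picks. The jobs in positions up to [k] have all started by [S (s k)], so the supply
    covers them. *)
Lemma feasible_can_start (S : schedule R I) (s : {perm job}) k :
    feasible S -> {homo (fun k => S (s k)) : i k / (i < k)%N >-> i < k} ->
  can_start s S k (S (s k)).
Proof.
move=> feasS incr; split; first exact: (start_ge0 feasS).
  by move=> i eq_ik; apply: feasible_seq feasS _; apply: incr; rewrite -eq_ik.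
apply: le_trans (enough_supply feasS (start_ge0 feasS (s k))).
rewrite [leRHS](reindex_inj (@perm_inj _ s)) /=.
rewrite big_mkcond [leRHS]big_mkcond; apply: ler_sum => i _.
case: ifP => [le_ik|_]; last by case: ifP => // _; rewrite ler0q (req_ge0 I_valid).
case: ifPn => //; rewrite -ltNge; move: le_ik; rewrite leq_eqVlt.
by case/predU1P=> [/val_inj->|/incr lt1 /(lt_trans lt1)]; rewrite ltxx.
Qed.

Lemma list_schedule_least (L S : schedule R I) (s : {perm job}) :
    list_schedule s L -> feasible S ->
    {homo (fun k => S (s k)) : i k / (i < k)%N >-> i < k} ->
  forall j, L j <= S j.
Proof.
move=> listL feasS incr j; rewrite -[j](permKV s); move: (s^-1%g j) => k {j}.
have [m] := ubnP k; elim: m k => // m IHm k lekm.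
have [S_ge0 prev enough] := feasible_can_start k feasS incr.
have [_] := listL k; apply; split=> // i eq_ik.
by apply: le_trans (prev i eq_ik); rewrite lerD2r IHm // -ltnS eq_ik.
Qed.

(** Both prefixes have equally many jobs, so [th] may be subtracted from every term. The prefix of
    [s] then collects only nonpositive terms and leaves out only nonnegative ones, which makes its
    sum minimal. *)
Lemma spt_prefix (s s' : {perm job}) (k : job) : nondecreasing_ptime s ->
  \sum_(i < n | (i <= k)%N) ptime (s i) <= \sum_(i < n | (i <= k)%N) ptime (s' i).
Proof.
move=> spt; set th := ptime (s k).
rewrite -(lerD2r (\sum_(i < n | (i <= k)%N) - th)) -!big_split /=.
rewrite (reindex_inj (@perm_inj _ s^-1%g)) [leRHS](reindex_inj (@perm_inj _ s'^-1%g)).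
rewrite big_mkcond [leRHS]big_mkcond; apply: ler_sum => j _; rewrite !permKV.
have below : (s^-1%g j <= k)%N -> ptime j - th <= 0.
  by move/spt; rewrite permKV subr_le0.
have above : ~~ (s^-1%g j <= k)%N -> 0 <= ptime j - th.
  by rewrite -ltnNge => /ltnW/spt; rewrite permKV subr_ge0.
by case: ifPn => [/below|/above]; case: ifP.
Qed.

(** The right-hand side satisfies [can_start]: by induction the predecessor is completed by then,
    and at [S (s' k)] the supply already covers [k + 1] equal requirements. *)
Lemma spt_delay (L S : schedule R I) (s s' : {perm job}) (k : job) :
    equal_requirements I -> list_schedule s L -> feasible S ->
    {homo (fun k => S (s' k)) : i k / (i < k)%N >-> i < k} ->
  L (s k) <= S (s' k) + \sum_(i < n | (i < k)%N) ratr (ptime (s i)).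
Proof.
move=> [abar req_eq] listL feasS incr.
have [m] := ubnP k; elim: m k => // m IHm k lekm.
have [S_ge0 prev enough] := feasible_can_start k feasS incr.
have pre_ge0 : 0 <= \sum_(i < n | (i < k)%N) ratr (ptime (s i)) :> R.
  by apply: sumr_ge0 => i _; rewrite ltW ?ptime_pos.
have [_] := listL k; apply; split; first exact: addr_ge0.
- move=> i eq_ik; rewrite /completion (bigD1 i) -?eq_ik  //= [leRHS]addrCA [leLHS]addrC lerD2l.
  apply: le_trans (IHm i _) _; first by rewrite -ltnS eq_ik.
  apply: lerD.
    by apply: le_trans (prev i eq_ik); rewrite lerDl ltW ?ptime_pos.
  rewrite le_eqVlt; apply/orP; left; apply/eqP; apply: eq_bigl => l.
  by rewrite ltnS -val_eqE /=; lia.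
- apply: le_trans (supplied_mono (_ : S (s' k) <= _)); last by rewrite lerDl.
  rewrite (eq_bigr (fun=> ratr abar)); last by move=> i _; rewrite req_eq.
  by rewrite (eq_bigr (fun=> ratr abar)) in enough => [|i _]; rewrite ?req_eq.
Qed.

Lemma completion_ge_prefix (S : schedule R I) (s : {perm job}) (k : job) :
    feasible S -> {homo (fun k => S (s k)) : i k / (i < k)%N >-> i < k} ->
  \sum_(i < n | (i <= k)%N) ratr (ptime (s i)) <= completion S (s k).
Proof.
move=> feasS incr.
have [m] := ubnP k; elim: m k => // m IHm k lekm.
rewrite /completion (bigD1 k) //= addrC lerD2r.
have [k0|k_gt0] := posnP k.
  rewrite big_pred0 ?(start_ge0 feasS) // => i; rewrite -val_eqE /= k0; lia.
have lt_k1 : (k.-1 < n)%N by apply: leq_ltn_trans (ltn_ord k); lia.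
have [_ prev _] := feasible_can_start k feasS incr.
apply: le_trans (prev (Ordinal lt_k1) (prednK k_gt0)).
apply: le_trans (IHm (Ordinal lt_k1) _) => /=; last lia.
rewrite le_eqVlt; apply/orP; left; apply/eqP; apply: eq_bigl => l.
by rewrite -val_eqE /=; lia.
Qed.

Lemma spt_le_twice (L S : schedule R I) (s : {perm job}) :
    equal_requirements I -> nondecreasing_ptime s -> list_schedule s L ->
    feasible S ->
  total_completion L <= 2 * total_completion S.
Proof.
move=> eq_req spt listL feasS; have [s' incr] := feasible_sorted feasS.
rewrite /total_completion (reindex_inj (@perm_inj _ s)) /=.
rewrite [X in 2 * X](reindex_inj (@perm_inj _ s')) mulr_sumr /=.
apply: ler_sum => k _; have delay := spt_delay k eq_req listL feasS incr.
have work := completion_ge_prefix k feasS incr.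
have: \sum_(i < n | (i <= k)%N) ratr (ptime (s i)) <=
      \sum_(i < n | (i <= k)%N) ratr (ptime (s' i)) :> R.
  by rewrite -!(rmorph_sum (ratr : {rmorphism rat -> R})) ler_rat spt_prefix.
have -> : \sum_(i < n | (i <= k)%N) ratr (ptime (s i)) =
    ratr (ptime (s k)) + \sum_(i < n | (i < k)%N) ratr (ptime (s i)) :> R.
  rewrite (bigD1 k) //=; congr (_ + _); apply: eq_bigl => i.
  by rewrite ltn_neqAle andbC.
(* The completion time under [L] is at most [S (s' k)] plus the work up to position [k], and each of
   these is at most the completion time of [s' k] under [S]. *)
have := ptime_pos (s' k); move: work delay; rewrite /completion; lra.
Qed.

End Feasibility.

(** * Start times of list scheduling by recursion *)

Definition nat_ext (n : nat) (f : 'I_n -> rat) (i : nat) : rat := oapp f 0 (insub i).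

Lemma nat_ext_ord n (f : 'I_n -> rat) (i : 'I_n) : nat_ext f i = f i.
Proof. by rewrite /nat_ext valK. Qed.

(** Programs address data by natural numbers; outside the index range, families and permutations
    alike are extended by 0. *)
Definition nat_perm (n : nat) (s : {perm 'I_n}) (k : nat) : nat :=
  oapp (fun i => val (s i)) 0%N (insub k).

Lemma nat_perm_ord n (s : {perm 'I_n}) (k : 'I_n) : nat_perm s k = s k.
Proof. by rewrite /nat_perm valK. Qed.

(* With equal requirements, list scheduling starts the job in position [k] at
   the latest of the previous completion time and the supply dates [sd l] before
   which strictly less than [k + 1] requirements have been supplied. *)
Section StartTimes.
Variables (abar : rat) (q : nat) (pt sd qt : nat -> rat) (ord : nat -> nat).

Definition supply_before (l : nat) : rat := \sum_(0 <= m < l) qt m.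

Fixpoint earliest (need prev : rat) (l : nat) : rat :=
  if l is l'.+1 then
    let t := earliest need prev l' in
    if (supply_before l' < need) && (t < sd l') then sd l' else t
  else prev.

Fixpoint finish (k : nat) : rat :=
  if k is k'.+1 then earliest (k'.+1%:R * abar) (finish k') q + pt (ord k') else 0.

Definition start (k : nat) : rat := earliest (k.+1%:R * abar) (finish k) q.

Lemma finishS k : finish k.+1 = start k + pt (ord k).
Proof. by []. Qed.

(** [earliest] is the maximum of [prev] and the dates that have to be awaited. Describing it by its
    real upper bounds matches the form of [least]. *)
Lemma earliest_le (R : realType) need prev l (t : R) :
  ratr (earliest need prev l) <= t <->
  ratr prev <= t /\
  forall m, (m < l)%N -> supply_before m < need -> ratr (sd m) <= t.
Proof.
elim: l => [|l IHl] /=; first by split=> [|[]].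
split.
  case: ifPn => [/andP[short /ltW late] le_t|].
    have [|prev_le IH] := IHl.1; first by apply: le_trans le_t; rewrite ler_rat.
    by split=> // m; rewrite ltnS leq_eqVlt => /predU1P[->|/IH].
  rewrite negb_and -!leNgt => step /IHl[prev_le IH]; split=> // m.
  rewrite ltnS leq_eqVlt => /predU1P[-> short|/IH//].
  move: step; rewrite leNgt short /= => sd_le.
  by apply: le_trans (IHl.2 (conj prev_le IH)); rewrite ler_rat.
case=> prev_le IH; case: ifP => [/andP[short _]|_]; first exact: IH.
by apply/IHl; split=> // m lt_ml; apply: IH; rewrite ltnW.
Qed.

Lemma finish_ge0 k : (forall i, 0 <= pt i) -> 0 <= finish k.
Proof.
move=> pt_ge0; elim: k => [|k IHk] //; rewrite finishS addr_ge0 //.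
apply: (le_trans IHk); rewrite /start; elim: q => //= l IHl.
by case: ifP => // /andP[_ /ltW]; exact: le_trans.
Qed.

End StartTimes.

(** * Existence of list schedules and of an optimum *)

Section Existence.
Variables (R : realType) (I : instance).
Hypothesis I_valid : valid_instance I.

Local Notation n := (njobs I).
Local Notation q := (nsupp I).
Local Notation pt := (nat_ext (ptime (i := I))).
Local Notation sd := (nat_ext (sdate (i := I))).
Local Notation qt := (nat_ext (sqty (i := I))).

Lemma supply_before_sum (l : nat) : (l <= q)%N ->
  supply_before qt l = \sum_(m < q | (m < l)%N) sqty m.
Proof.
move=> le_lq; rewrite /supply_before big_mkord (big_ord_widen _ _ le_lq).
by apply: eq_bigr => m _; rewrite nat_ext_ord.
Qed.

(** Dates increase, so the supplies received by [t] form an initial segment. It suffices exactly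
    when every date with too little supply before it has passed. *)
Lemma supplied_ge (need : rat) (t : R) :
    need <= \sum_(l < q) sqty l ->
  ratr need <= supplied I t <->
  forall m, (m < q)%N -> supply_before qt m < need -> ratr (sd m) <= t.
Proof.
move=> le_total.
have -> : supplied I t = ratr (\sum_(l < q | ratr (sdate l) <= t) sqty l).
  by rewrite rmorph_sum.
rewrite ler_rat; split=> [enough m lt_mq short|reached].
  rewrite leNgt; apply/negP => lt_t; move: short; rewrite ltNge => /negP; apply.
  apply: le_trans enough _; rewrite supply_before_sum ?(ltnW lt_mq) //.
  rewrite big_mkcond [leRHS]big_mkcond; apply: ler_sum => l _.
  case: ifP => [le_t|_]; last by case: ifP => // _; rewrite ltW ?(sqty_gt0 I_valid).
  rewrite ltnNge; case: leqP => // le_ml; exfalso.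
  have: ratr (sd m) <= ratr (sdate l) :> R.
    rewrite (nat_ext_ord _ (Ordinal lt_mq)) ler_rat.
    move: le_ml; rewrite leq_eqVlt => /predU1P[eq_ml|lt_ml].
      by rewrite le_eqVlt (_ : Ordinal lt_mq = l) ?eqxx //; apply: val_inj.
    exact/ltW/(sdate_incr I_valid).
  by move/le_trans=> /(_ _ le_t); rewrite leNgt lt_t.
(* If no date lies after [t], the total supply has arrived. Otherwise let [l] be the first such
   date: the supplies before it have arrived, and they cover [need]. *)
have [l0 late|none] := pickP (fun l : 'I_q => t < ratr (sdate l)); last first.
  by rewrite (eq_bigl predT) // => l; rewrite leNgt none.
case: (@arg_minnP _ l0 (fun l => t < ratr (sdate l)) val late) => l lt_t l_min.
have le_need : need <= supply_before qt l.
  rewrite leNgt; apply/negP => /(reached l (ltn_ord l)).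
  by rewrite nat_ext_ord leNgt lt_t.
apply: le_trans le_need _; rewrite supply_before_sum ?(ltnW (ltn_ord l)) //.
rewrite big_mkcond [leRHS]big_mkcond; apply: ler_sum => m _; case: ifP => lt_ml.
  by case: (leP (ratr (sdate m)) t) => // /l_min; rewrite /= leqNgt lt_ml.
by case: ifP => // _; rewrite ltW ?(sqty_gt0 I_valid).
Qed.

Variable abar : rat.
Hypothesis req_eq : forall j, req (i := I) j = abar.

Lemma requirement_prefix (s : {perm 'I_n}) (k : 'I_n) :
  \sum_(i < n | (i <= k)%N) req (s i) = k.+1%:R * abar.
Proof.
rewrite (eq_bigr (fun=> abar)) => [|i _]; last exact: req_eq.
rewrite -(big_ord_widen _ (fun=> abar) (ltn_ord k)) sumr_const card_ord.
by rewrite mulr_natl.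
Qed.

(** Total requirement equals total supply, so no prefix waits for a supply that never comes. *)
Lemma requirement_prefix_le (k : 'I_n) :
  k.+1%:R * abar <= \sum_(l < q) sqty (i := I) l.
Proof.
rewrite -(requirement_prefix 1) -(req_total I_valid) big_mkcond.
apply: ler_sum => i _; rewrite perm1; case: ifP => // _; exact: req_ge0 I_valid i.
Qed.

Definition list_start (s : {perm 'I_n}) (j : 'I_n) : rat :=
  start abar q pt sd qt (nat_perm s) (s^-1%g j).

Definition list_times (s : {perm 'I_n}) : schedule R I :=
  fun j => ratr (list_start s j).

Lemma list_times_schedule (s : {perm 'I_n}) : list_schedule s (list_times s).
Proof.
move=> k.
suff can_startE t : can_start s (list_times s) k t <-> list_times s (s k) <= t.
  by split=> [|t /can_startE//]; apply/can_startE.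
have pt_ge0 i : 0 <= pt i.
  by rewrite /nat_ext; case: insubP => //= j _ _; rewrite ltW ?(ptime_gt0 I_valid).
have completionE (i : 'I_n) : completion (list_times s) (s i) =
    ratr (finish abar q pt sd qt (nat_perm s) i.+1).
  rewrite /completion /list_times /list_start permK finishS nat_perm_ord.
  by rewrite nat_ext_ord rmorphD.
have supplyE : \sum_(i < n | (i <= k)%N) ratr (req (s i)) =
    ratr (k.+1%:R * abar) :> R.
  by rewrite -(requirement_prefix s) rmorph_sum.
rewrite /list_times /list_start permK; split.
  case=> t_ge0 prev enough; apply/earliest_le; split.
    (* The first position has no predecessor; there [finish] is 0 and the bound is nonnegativity of
       [t]. *)
    case: (posnP k) => [->|k_gt0]; first by rewrite rmorph0.
    have lt_k1 : (k.-1 < n)%N by apply: leq_ltn_trans (ltn_ord k); lia.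
    rewrite -(prednK k_gt0) -(completionE (Ordinal lt_k1)); apply: prev.
    exact: prednK.
  by apply/(supplied_ge _ (requirement_prefix_le k)); rewrite -supplyE.
case/earliest_le=> le_t reached; split.
- by apply: le_trans le_t; rewrite ler0q finish_ge0.
- by move=> i eq_ik; rewrite completionE eq_ik.
- by rewrite supplyE; apply/(supplied_ge _ (requirement_prefix_le k)).
Qed.

Lemma optimum_exists : exists OPT : R, optimum I OPT.
Proof.
pose total s := total_completion (list_times s).
case: (@Order.TotalTheory.arg_minP _ _ _ (1%g : {perm 'I_n}) predT total isT) => s _ s_min.
exists (total s); split.
  exists (list_times s) => //.
  exact: list_schedule_feasible I_valid _ _ (list_times_schedule s).
move=> _ [S feasS ->]; have [s' incr] := feasible_sorted I_valid feasS.
apply: le_trans (s_min s' isT) _; apply: ler_sum => j _; rewrite lerD2r.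
exact: (list_schedule_least I_valid (list_times_schedule s') feasS incr).
Qed.

End Existence.

(** * Cost of programs *)

Section Cost.
Local Open Scope nat_scope.

Lemma ltn_bitlen n : n < 2 ^ bitlen n.
Proof. exact: trunc_log_ltn. Qed.

Lemma bitlen_le b n : 0 < b -> n < 2 ^ b -> bitlen n <= b.
Proof.
move=> b_gt0 lt_n; rewrite /bitlen; case: (posnP n) => [->|n_gt0].
  by rewrite trunc_log0.
by rewrite -(ltn_exp2l _ _ (isT : 1 < 2)) (leq_ltn_trans _ lt_n) ?trunc_logP.
Qed.

Lemma bitlen_mono : {homo bitlen : a b / a <= b}.
Proof. by move=> a b le_ab; rewrite ltnS leq_trunc_log. Qed.

Lemma bitlenM a b : bitlen (a * b) <= bitlen a + bitlen b.
Proof.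
apply: bitlen_le; rewrite ?addn_gt0 // expnD.
by apply: ltn_mul; exact: ltn_bitlen.
Qed.

Lemma bitlenD a b : bitlen (a + b) <= bitlen a + bitlen b.
Proof.
apply: bitlen_le; rewrite ?addn_gt0 // expnD.
have pow_ge2 c : 2 <= 2 ^ bitlen c by rewrite -{1}(expn1 2) leq_exp2l.
have := ltn_bitlen a; have := ltn_bitlen b; have := pow_ge2 a; have := pow_ge2 b.
by move: (2 ^ _) (2 ^ _) => x y; nia.
Qed.

Definition bounded (b : nat) (m : memory) : Prop := forall a i, m a i < 2 ^ b.

(** One coefficient serves both bounds of [expr_cost_bound], linear in [b] for the bit length and
    quadratic for the cost. The product term pays for multiplications. *)
Fixpoint expr_cost (e : expr) : nat :=
  match e with
  | Cst n => bitlen n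
  | Get _ e1 => 2 * expr_cost e1 + 1
  | Add e1 e2 | Defs.Sub e1 e2 | Mul e1 e2 =>
      2 * (expr_cost e1 + expr_cost e2) + expr_cost e1 * expr_cost e2
  end.

Fixpoint cmd_cost (c : cmd) : nat :=
  match c with
  | Skip => 1
  | Put _ e1 e2 => 2 * (expr_cost e1 + expr_cost e2)
  | Seq c1 c2 => cmd_cost c1 + cmd_cost c2
  | If e c1 c2 => expr_cost e + cmd_cost c1 + cmd_cost c2
  | While e c1 => expr_cost e + cmd_cost c1
  end.

Lemma expr_cost_bound b m e : 0 < b -> bounded b m ->
  bitlen (eval m e) <= expr_cost e * b /\ ecost m e <= expr_cost e * (b * b).
Proof.
move=> b_gt0 m_bounded.
have square k : k * b <= k * (b * b) by rewrite leq_mul2l leq_pmulr ?orbT.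
elim: e => [n|a e1 [len1 cost1]|||] /=.
- by rewrite !leq_pmulr // muln_gt0 b_gt0.
- have := bitlen_le b_gt0 (m_bounded a (eval m e1)).
  have := square (expr_cost e1); have := square 1.
  by split; lia.
all: move=> e1 [len1 cost1] e2 [len2 cost2].
all: have := square (expr_cost e1); have := square (expr_cost e2).
all: move: (leq_mul len1 len2); rewrite mulnACA.
- have := bitlenD (eval m e1) (eval m e2).
  by split; lia.
- have := bitlen_mono (leq_subr (eval m e2) (eval m e1)).
  by split; lia.
- have := bitlenM (eval m e1) (eval m e2).
  by split; lia.
Qed.

(* The factor [s] counts how often the loop bodies of [c] are entered; the cost
   of a single pass through [c] depends on the run only through the bound [b] on
   the bit lengths of the cells. *)
Definition terminates (b : nat) (c : cmd) (m : memory) (s : nat)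
    (Q : memory -> Prop) : Prop :=
  exists m' t, [/\ exec c m m' t, t <= cmd_cost c * (b * b) * s, bounded b m' & Q m'].

Variables (b : nat).
Hypothesis b_gt0 : 0 < b.

Lemma terminates_weaken c m s s' (Q Q' : memory -> Prop) : s <= s' ->
    (forall m', bounded b m' -> Q m' -> Q' m') ->
  terminates b c m s Q -> terminates b c m s' Q'.
Proof.
move=> le_s QQ' [m' [t [run cost m'_bounded Qm']]].
exists m', t; split; rewrite ?(leq_trans cost) ?leq_mul //.
exact: QQ'.
Qed.

Lemma terminates_skip m s (Q : memory -> Prop) : 0 < s -> bounded b m -> Q m ->
  terminates b Skip m s Q.
Proof. by move=> s_gt0 m_bounded Qm; exists m, 1; split=> //=; [constructor|nia]. Qed.

Lemma bounded_update m a i v :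
  bounded b m -> v < 2 ^ b -> bounded b (update m a i v).
Proof. by move=> m_bounded lt_v a' i'; rewrite /update; case: ifP. Qed.

Lemma terminates_put a e1 e2 m s (Q : memory -> Prop) :
    0 < s -> bounded b m -> eval m e2 < 2 ^ b ->
    Q (update m a (eval m e1) (eval m e2)) ->
  terminates b (Put a e1 e2) m s Q.
Proof.
move=> s_gt0 m_bounded lt_v Qm.
exists (update m a (eval m e1) (eval m e2)).
exists (ecost m e1 + ecost m e2 + bitlen (eval m e1) + bitlen (eval m e2)).
split=> //=; [exact: ExecPut| |exact: bounded_update].
have [len1 cost1] := expr_cost_bound e1 b_gt0 m_bounded.
have [len2 cost2] := expr_cost_bound e2 b_gt0 m_bounded.
apply: leq_trans (leq_pmulr _ s_gt0); nia.
Qed.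

Lemma terminates_seq c1 c2 m s (P Q : memory -> Prop) :
    terminates b c1 m s P ->
    (forall m1, bounded b m1 -> P m1 -> terminates b c2 m1 s Q) ->
  terminates b (Seq c1 c2) m s Q.
Proof.
move=> [m1 [t1 [run1 cost1 m1_bounded Pm1]]].
move=> /(_ m1 m1_bounded Pm1) [m2 [t2 [run2 cost2 m2_bounded Qm2]]].
exists m2, (t1 + t2); split=> //=; first exact: ExecSeq run1 run2.
by rewrite !mulnDl leq_add.
Qed.

Lemma terminates_if e c1 c2 m s (Q : memory -> Prop) : 0 < s -> bounded b m ->
    (eval m e != 0 -> terminates b c1 m s Q) ->
    (eval m e = 0 -> terminates b c2 m s Q) ->
  terminates b (If e c1 c2) m s Q.
Proof.
move=> s_gt0 m_bounded run1 run2.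
have [_ coste] := expr_cost_bound e b_gt0 m_bounded.
have cost_e : ecost m e <= expr_cost e * (b * b) * s.
  exact: leq_trans coste (leq_pmulr _ s_gt0).
case: (eqVneq (eval m e) 0) => [e0|e_neq0].
  have [m' [t [run cost m'_bounded Qm']]] := run2 e0.
  exists m', (ecost m e + t); split=> //=; first exact: ExecIfFalse.
  by rewrite !mulnDl; lia.
have [m' [t [run cost m'_bounded Qm']]] := run1 e_neq0.
exists m', (ecost m e + t); split=> //=; first exact: ExecIfTrue.
by rewrite !mulnDl; lia.
Qed.

(** The truncated difference in the guard is nonzero exactly while the counter is below [e]. The
    bound [e] is evaluated again before each pass, so loop invariants must fix its value. *)
Definition For (v : nat) (e : expr) (c : cmd) : cmd :=
  Seq (Put v (Cst 0) (Cst 0))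
    (While (Defs.Sub e (Get v (Cst 0)))
      (Seq c (Put v (Cst 0) (Add (Get v (Cst 0)) (Cst 1))))).

Lemma terminates_for v e c n s m (Inv : nat -> memory -> Prop) :
    0 < s -> bounded b m -> n < 2 ^ b ->
    (forall i m, Inv i m -> m v 0 = i /\ eval m e = n) ->
    Inv 0 (update m v 0 0) ->
    (forall i m, i < n -> bounded b m -> Inv i m ->
      terminates b c m s (fun m' => m' v 0 = i /\ Inv i.+1 (update m' v 0 i.+1))) ->
  terminates b (For v e c) m (n.+1 * s) (Inv n).
Proof.
move=> s_gt0 m_bounded lt_n InvP Inv0 step.
apply: (@terminates_seq _ _ _ _ (Inv 0)).
  by apply: terminates_put => //=; rewrite ?muln_gt0 // expn_gt0.
set g := Defs.Sub _ _; set body := Seq _ _.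
(* Here [r] counts the remaining passes; the additional unit pays for the final, failing guard. *)
suff loop r i m1 : i + r = n -> bounded b m1 -> Inv i m1 ->
    terminates b (While g body) m1 (r.+1 * s) (Inv n).
  by move=> m1 m1_bounded; apply: loop.
have cost_while : cmd_cost (While g body) = expr_cost g + cmd_cost body by [].
elim: r i m1 => [|r IHr] i m1 eq_n m1_bounded Inv_i;
  have [v_i e_n] := InvP i m1 Inv_i;
  have [_ guard] := expr_cost_bound g b_gt0 m1_bounded.
  rewrite addn0 in eq_n; exists m1, (ecost m1 g); split=> //; last by rewrite -eq_n.
    by apply: ExecWhileFalse; rewrite /= e_n v_i eq_n subnn.
  rewrite mul1n; apply: leq_trans guard (leq_trans _ (leq_pmulr _ s_gt0)).
  by rewrite leq_mul2r leq_addr orbT.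
have lt_in : i < n by lia.
have [m2 [t1 [run1 cost1 m2_bounded Inv_Si]]] : terminates b body m1 s (Inv i.+1).
  apply: terminates_seq (step i m1 lt_in m1_bounded Inv_i) _ => m2 m2_bounded [v_i2 Inv2].
  apply: terminates_put => //=; rewrite v_i2 addn1 //.
  exact: leq_ltn_trans lt_in lt_n.
have [|m3 [t2 [run2 cost2 m3_bounded Inv_n]]] := IHr i.+1 m2 _ m2_bounded Inv_Si.
  by rewrite addSnnS.
exists m3, (ecost m1 g + t1 + t2); split=> //.
  by apply: ExecWhileTrue run1 run2; rewrite /= e_n v_i; lia.
rewrite cost_while in cost2 *.
have : expr_cost g * (b * b) <= expr_cost g * (b * b) * s by rewrite leq_pmulr.
rewrite mulSn mulnDr; move: guard cost1 cost2.
move: (cmd_cost body) (expr_cost g) (ecost m1 g) => kc kg tg; lia.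
Qed.

End Cost.

(** * The program *)

(* [a / b] represents [x], not necessarily in lowest terms. *)
Definition frac (a b : nat) (x : rat) : Prop := (0 < b)%N /\ a%:R = x * b%:R.

Lemma frac_lt a b c d x y : frac a b x -> frac c d y ->
  (c * b < a * d)%N = (y < x).
Proof.
move=> [b_gt0 ax] [d_gt0 cy]; rewrite -(ltr_nat rat) !natrM ax cy.
by rewrite mulrAC !ltr_pM2r ?ltr0n.
Qed.

Lemma fracD a b c d x y : frac a b x -> frac c d y ->
  frac (a * d + c * b) (b * d) (x + y).
Proof.
move=> [b_gt0 ax] [d_gt0 cy]; split; first by rewrite muln_gt0 b_gt0.
by rewrite natrD !natrM ax cy; ring.
Qed.

Local Notation var a := (Get a (Cst 0)).
Local Notation twice e := (Add e e).
Local Notation size_jobs := (Get 0 (Cst 0)).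
Local Notation size_supplies := (Get 0 (Cst 1)).
(** After the two sizes, the four families are stored contiguously as pairs, so all are addressed as
    a continuation of the processing times: requirements from index [n], dates from [2n], quantities
    from [2n + q]. As requirements are equal, the program reads the first one. *)
Local Notation ptime_num i := (Get 0 (Add (Cst 2) (twice i))).
Local Notation ptime_den i := (Get 0 (Add (Cst 3) (twice i))).
Local Notation req_num := (ptime_num size_jobs).
Local Notation req_den := (ptime_den size_jobs).
Local Notation date_num l := (ptime_num (Add (twice size_jobs) l)).
Local Notation date_den l := (ptime_den (Add (twice size_jobs) l)).
Local Notation qty_num l := (date_num (Add size_supplies l)).
Local Notation qty_den l := (date_den (Add size_supplies l)).

(* [1 - (1 - (y - x))] is the truth value of [x < y]; the key of job [i] is its
   processing time, with ties broken by the index.  Cell [r] of array 2 receives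
   the job of rank [r]. *)
Definition rank_prog : cmd :=
  For 3 size_jobs
    (Seq (Put 5 (Cst 0) (Cst 0))
    (Seq (For 4 size_jobs
            (Put 5 (Cst 0) (Add (var 5) (Defs.Sub (Cst 1) (Defs.Sub (Cst 1) (Defs.Sub
               (Add (Mul (Mul (ptime_num (var 3)) (ptime_den (var 4))) size_jobs) (var 3))
               (Add (Mul (Mul (ptime_num (var 4)) (ptime_den (var 3))) size_jobs) (var 4))))))))
         (Put 2 (var 5) (var 3)))).

(* Variables 6 and 7 hold the current time, 8 and 9 the quantity supplied before
   the date under consideration, both as numerator and denominator. *)
Definition list_prog : cmd :=
  let job := Get 2 (var 3) in
  Seq (Put 6 (Cst 0) (Cst 0))
  (Seq (Put 7 (Cst 0) (Cst 1))
  (For 3 size_jobs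
    (Seq (Put 8 (Cst 0) (Cst 0))
    (Seq (Put 9 (Cst 0) (Cst 1))
    (Seq (For 4 size_supplies
           (Seq (If (Mul
                   (Defs.Sub (Mul (Mul (Add (var 3) (Cst 1)) req_num) (var 9)) (Mul (var 8) req_den))
                   (Defs.Sub (Mul (date_num (var 4)) (var 7)) (Mul (var 6) (date_den (var 4)))))
                 (Seq (Put 6 (Cst 0) (date_num (var 4))) (Put 7 (Cst 0) (date_den (var 4))))
                 Skip)
           (Seq (Put 8 (Cst 0) (Add (Mul (var 8) (qty_den (var 4))) (Mul (qty_num (var 4)) (var 9))))
                (Put 9 (Cst 0) (Mul (var 9) (qty_den (var 4)))))))
    (Seq (Put 1 (twice job) (var 6))
    (Seq (Put 1 (Add (Cst 1) (twice job)) (var 7))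
    (Seq (Put 6 (Cst 0) (Add (Mul (var 6) (ptime_den job)) (Mul (ptime_num job) (var 7))))
         (Put 7 (Cst 0) (Mul (var 7) (ptime_den job))))))))))).

Definition num_at (rd : nat -> nat) (i : nat) : nat := rd (2 + (i + i))%N.
Definition den_at (rd : nat -> nat) (i : nat) : nat := rd (3 + (i + i))%N.

(** * Correctness and cost of the program *)

Section Program.
Local Open Scope nat_scope.
Variables (rd : nat -> nat) (beta b : nat).
Local Notation n := (rd 0).
Local Notation q := (rd 1).
Local Notation pnum := (num_at rd).
Local Notation pden := (den_at rd).

Hypothesis rd_lt : forall i, rd i < 2 ^ beta.
Hypothesis beta_gt0 : 0 < beta.
Hypothesis b_ge : beta * (2 * (n + q) + 4) <= b.

(** Distinct cross products differ by at least [n] after scaling, more than two indices below [n]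
    can; hence the indices only break ties. *)
Definition earlier (i j : nat) : bool :=
  pnum i * pden j * n + i < pnum j * pden i * n + j.

Definition rank_of (j : nat) : nat := \sum_(0 <= i < n) earlier i j.

Lemma b_gt0 : 0 < b.
Proof. by apply: leq_trans b_ge; rewrite muln_gt0 beta_gt0 addnS. Qed.

Lemma small_lt x e : e <= 2 * (n + q) + 4 -> x < (2 ^ beta) ^ e -> x < 2 ^ b.
Proof.
move=> le_e /leq_trans; apply; rewrite -expnM leq_exp2l //.
by apply: leq_trans b_ge; rewrite leq_mul2l le_e orbT.
Qed.

Lemma rd_small i : rd i < 2 ^ b.
Proof. by apply: (@small_lt _ 1); rewrite ?expn1 // addnS. Qed.

(** Injectivity of ranks keeps a later write to array 2 from overwriting an earlier job. The two
    nested loops give the square. *)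
Lemma terminates_rank m :
    (forall i j, i < n -> j < n -> rank_of i = rank_of j -> i = j) ->
    bounded b m -> m 0 =1 rd ->
  terminates b rank_prog m (n.+1 * n.+1) (fun m' =>
    m' 0 =1 rd /\ forall j, j < n -> m' 2 (rank_of j) = j).
Proof.
move=> rank_inj m_bounded m0.
have n_small : n < 2 ^ b by exact: rd_small.
pose Outer j m := [/\ m 3 0 = j, m 0 =1 rd &
  forall i, i < j -> m 2 (rank_of i) = i].
apply: (@terminates_weaken b _ _ _ _ (Outer n)) (leqnn _) _ _.
  by move=> m' _ [_ m0' ranks].
apply: (@terminates_for b b_gt0 _ _ _ n n.+1 _ Outer) => //.
- by move=> i m1 [-> m01 _] /=; rewrite m01.
move=> j m1 lt_jn m1_bounded [v3 m01 ranks].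
apply: (@terminates_seq b _ _ _ _ (fun m' => m' = update m1 5 0 0)).
  by apply: (terminates_put b_gt0); rewrite //= expn_gt0.
move=> _ /[swap]-> m1'_bounded.
pose Inner i m := [/\ m 4 0 = i, m 5 0 = \sum_(0 <= i' < i) earlier i' j & Outer j m].
(* Keeps the counting cell within the bit bound. *)
have sum_le i : \sum_(0 <= i' < i) earlier i' j <= i.
  rewrite -[leqRHS]subn0 -[leqRHS]muln1 -sum_nat_const_nat.
  by apply: leq_sum => i' _; case: (earlier _ _).
apply: (@terminates_seq b _ _ _ _ (Inner n)).
  rewrite -[n.+1]muln1.
  apply: (@terminates_for b b_gt0 _ _ _ n 1 _ Inner) => //.
  - by move=> i m2 [-> _ [_ m02 _]] /=; rewrite m02.
  - by split=> //; rewrite big_geq.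
  move=> i m2 lt_in m2_bounded [v4 v5 [v3' m02 ranks2]].
  have inc : eval m2 (Defs.Sub (Cst 1) (Defs.Sub (Cst 1) (Defs.Sub
      (Add (Mul (Mul (ptime_num (var 3)) (ptime_den (var 4))) size_jobs) (var 3))
      (Add (Mul (Mul (ptime_num (var 4)) (ptime_den (var 3))) size_jobs) (var 4)))))
      = earlier i j.
    rewrite /= v3' v4 !m02 /earlier /num_at /den_at.
    by case: ltnP; lia.
  have sum_next : \sum_(0 <= i' < i.+1) earlier i' j =
      eval m2 (Add (var 5) (Defs.Sub (Cst 1) (Defs.Sub (Cst 1) (Defs.Sub
      (Add (Mul (Mul (ptime_num (var 3)) (ptime_den (var 4))) size_jobs) (var 3))
      (Add (Mul (Mul (ptime_num (var 4)) (ptime_den (var 3))) size_jobs) (var 4)))))).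
    by rewrite big_nat_recr //= -v5 -inc.
  apply: (terminates_put b_gt0) => //; rewrite -sum_next.
    exact: leq_ltn_trans (sum_le i.+1) (leq_ltn_trans lt_in n_small).
move=> m2 m2_bounded [v4 v5 [v3' m02 ranks2]].
apply: (terminates_put b_gt0) => //=.
rewrite v3' v5; split=> //; split=> // i; rewrite ltnS leq_eqVlt /update /=.
case/predU1P => [->|lt_ij]; first by rewrite eqxx.
case: eqP => [eq_rank|_]; last exact: ranks2.
have lt_in := ltn_trans lt_ij lt_jn.
exact/esym/rank_inj.
Qed.

Variables (abar : rat) (pt sd qt : nat -> rat) (ord : nat -> nat).
Hypothesis pt_frac : forall i, i < n -> frac (pnum i) (pden i) (pt i).
Hypothesis abar_frac : frac (pnum n) (pden n) abar.
Hypothesis sd_frac : forall l, l < q ->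
  frac (pnum (n + n + l)) (pden (n + n + l)) (sd l).
Hypothesis qt_frac : forall l, l < q ->
  frac (pnum (n + n + (q + l))) (pden (n + n + (q + l))) (qt l).
Hypothesis ord_lt : forall k, k < n -> ord k < n.
Hypothesis ord_inj : forall i k, i < n -> k < n -> ord i = ord k -> i = k.

Local Notation finish := (finish abar q pt sd qt ord).
Local Notation start := (start abar q pt sd qt ord).

(* [a / c] is a sum of at most [k + 1] input fractions: each addition multiplies
   the denominator by at most [2 ^ beta] and the numerator by at most its square. *)
Definition tracks (k a c : nat) (x : rat) : Prop :=
  [/\ frac a c x, a < (2 ^ beta) ^ (2 * k + 1) & c < (2 ^ beta) ^ (k + 1)].

Lemma base_ge2 : 2 <= 2 ^ beta.
Proof. by rewrite -{1}(expn1 2) leq_exp2l. Qed.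

Lemma tracks0 : tracks 0 0 1 0%R.
Proof. by split; rewrite ?expn_gt0 ?expn1 ?base_ge2. Qed.

(** A single input fraction meets the bounds for every [k], so resetting the current time to a
    supply date preserves them. *)
Lemma tracks_input k i x : frac (pnum i) (pden i) x -> tracks k (pnum i) (pden i) x.
Proof.
have base_le e : 2 ^ beta <= (2 ^ beta) ^ (e + 1).
  by rewrite -{1}(expn1 (2 ^ beta)) leq_exp2l ?base_ge2 // addn1.
by move=> i_frac; split=> //; apply: leq_trans (rd_lt _) (base_le _).
Qed.

Lemma tracksD k a c i x y : tracks k a c x -> frac (pnum i) (pden i) y ->
  tracks k.+1 (a * pden i + pnum i * c) (c * pden i) (x + y).
Proof.
move=> [ac_frac lt_a lt_c] i_frac; split; first exact: fracD ac_frac i_frac.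
  have lt1 : a * pden i < (2 ^ beta) ^ (2 * k + 2).
    by rewrite addnS expnSr; apply: ltn_mul lt_a (rd_lt _).
  have lt2 : pnum i * c < (2 ^ beta) ^ (2 * k + 2).
    apply: (@leq_trans ((2 ^ beta) ^ (k + 2))); last first.
      by rewrite leq_exp2l ?base_ge2 //; lia.
    by rewrite addnS expnS; apply: ltn_mul (rd_lt _) lt_c.
  (* The spare factor [2 ^ beta] is at least 2 and absorbs the sum of the two products. *)
  rewrite (_ : 2 * k.+1 + 1 = (2 * k + 2).+1) ?expnS; last lia.
  apply: leq_trans (leq_mul base_ge2 (leqnn _)).
  by move: lt1 lt2; move: (_ ^ _) => u; lia.
by rewrite addSn expnSr; apply: ltn_mul lt_c (rd_lt _).
Qed.

Lemma tracks_small k a c x : k <= n + q -> tracks k a c x ->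
  (a < 2 ^ b) * (c < 2 ^ b).
Proof.
move=> le_k [_ lt_a lt_c]; split.
  by apply: small_lt lt_a; lia.
by apply: small_lt lt_c; lia.
Qed.

Lemma need_frac k : frac ((k + 1) * pnum n) (pden n) (k.+1%:R * abar)%R.
Proof.
have [den_gt0 num_eq] := abar_frac; split=> //.
by rewrite addn1 natrM num_eq mulrA.
Qed.

Definition started (k : nat) (out : nat -> nat) : Prop :=
  forall i, i < k -> frac (out (ord i + ord i)) (out (1 + (ord i + ord i))) (start i).

Definition settled (k : nat) (m : memory) : Prop :=
  [/\ m 3 0 = k, m 0 =1 rd, forall i, i < n -> m 2 i = ord i & started k (m 1)].

(** The invariants follow the recursions: cells 6 and 7 track [finish] in the outer loop and
    [earliest] in the inner one, while 8 and 9 track [supply_before]. *)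
Lemma terminates_list m :
    bounded b m -> m 0 =1 rd -> (forall i, i < n -> m 2 i = ord i) ->
  terminates b list_prog m (n.+1 * q.+1) (fun m' => started n (m' 1)).
Proof.
move=> m_bounded m0 m2.
have n_small : n < 2 ^ b by exact: rd_small.
have q_small : q < 2 ^ b by exact: rd_small.
have one_small : 1 < 2 ^ b by rewrite -{1}(expn0 2) ltn_exp2l ?b_gt0.
have bgt := b_gt0.
pose Outer k m := settled k m /\ tracks k (m 6 0) (m 7 0) (finish k).
apply: (@terminates_seq b _ _ _ _ (fun m' => m' = update m 6 0 0)).
  by apply: (terminates_put bgt); rewrite //= expn_gt0.
move=> _ /[swap]-> ma_bounded.
apply: (@terminates_seq b _ _ _ _ (fun m' => m' = update (update m 6 0 0) 7 0 1)).
  by apply: (terminates_put bgt).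
move=> _ /[swap]-> mb_bounded.
apply: (@terminates_weaken b _ _ _ _ (Outer n)) (leqnn _) _ _.
  by move=> m' _ [[]].
apply: (@terminates_for b bgt _ _ _ n q.+1 _ Outer) => //.
- by move=> k m1 [[-> m01 _ _] _] /=; rewrite m01.
- by split; [split=> // i|exact: tracks0].
move=> k m1 lt_kn m1_bounded [[v3 m01 m12 out1] time1].
apply: (@terminates_seq b _ _ _ _ (fun m' => m' = update m1 8 0 0)).
  by apply: (terminates_put bgt); rewrite //= expn_gt0.
move=> _ /[swap]-> m1a_bounded.
apply: (@terminates_seq b _ _ _ _ (fun m' => m' = update (update m1 8 0 0) 9 0 1)).
  by apply: (terminates_put bgt).
move=> _ /[swap]-> m1b_bounded.
pose time l := earliest sd qt (k.+1%:R * abar) (finish k) l.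
pose Inner l m := [/\ m 4 0 = l, settled k m,
  tracks l (m 8 0) (m 9 0) (supply_before qt l) & tracks k (m 6 0) (m 7 0) (time l)].
apply: (@terminates_seq b _ _ _ _ (Inner q)).
  rewrite -[q.+1]muln1.
  apply: (@terminates_for b bgt _ _ _ q 1 _ Inner) => //.
  - by move=> l m3 [-> [_ m03 _ _] _ _] /=; rewrite m03.
  - by split=> //; rewrite /supply_before big_geq //; exact: tracks0.
  move=> l m3 lt_lq m3_bounded [v4 [v3' m03 m32 out3] supply3 time3].
  apply: (@terminates_seq b _ _ _ _ (fun m' => [/\ m' 4 0 = l, settled k m',
      tracks l (m' 8 0) (m' 9 0) (supply_before qt l) &
      tracks k (m' 6 0) (m' 7 0) (time l.+1)])).
    (* A product of truncated differences is nonzero exactly when both strict inequalities hold, so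
       it acts as a conjunction. *)
    have guardE : (eval m3 (Mul
        (Defs.Sub (Mul (Mul (Add (var 3) (Cst 1)) req_num) (var 9)) (Mul (var 8) req_den))
        (Defs.Sub (Mul (date_num (var 4)) (var 7)) (Mul (var 6) (date_den (var 4))))) != 0)
        = (supply_before qt l < k.+1%:R * abar)%R && (time l < sd l)%R.
      case: supply3 => supply_fr _ _; case: time3 => time_fr _ _.
      rewrite -(frac_lt (need_frac k) supply_fr) -(frac_lt (sd_frac lt_lq) time_fr).
      rewrite [eval _ _]/= v3' v4 !m03 muln_eq0 negb_or !subn_eq0 -!ltnNge.
      by [].
    apply: (terminates_if bgt) => // guard; last first.
      apply: terminates_skip => //; split=> //.
      by move: guardE; rewrite guard /= /time /= => <-.
    have date_tracks := tracks_input k (sd_frac lt_lq).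
    have evalE : eval m3 (date_num (var 4)) = pnum (n + n + l).
      by rewrite /= v4 !m03.
    apply: (@terminates_seq b _ _ _ _
      (fun m' => m' = update m3 6 0 (pnum (n + n + l)))).
      by rewrite -evalE; apply: (terminates_put bgt) => //; rewrite evalE rd_small.
    move=> _ /[swap]-> m4_bounded.
    have evalE' : eval (update m3 6 0 (pnum (n + n + l))) (date_den (var 4)) =
        pden (n + n + l) by rewrite /= /update /= v4 !m03.
    apply: (terminates_put bgt) => //; rewrite evalE' ?rd_small //.
    split=> //; rewrite /time /=; move: guardE; rewrite guard => <- //.
  move=> {v4 v3' m03 m32 out3 supply3 time3} {}m3 {}m3_bounded.
  move=> [v4 [v3' m03 m32 out3] supply3 time3].
  have supply4 := tracksD supply3 (qt_frac lt_lq).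
  have [|num_small den_small] := tracks_small _ supply4; first lia.
  have numE : eval m3 (Add (Mul (var 8) (qty_den (var 4))) (Mul (qty_num (var 4)) (var 9))) =
      m3 8 0 * pden (n + n + (q + l)) + pnum (n + n + (q + l)) * m3 9 0.
    by rewrite /= v4 !m03.
  set num := _ + _ in numE num_small supply4.
  apply: (@terminates_seq b _ _ _ _ (fun m' => m' = update m3 8 0 num)).
    by rewrite -numE; apply: (terminates_put bgt) => //; rewrite numE.
  move=> _ /[swap]-> m4_bounded.
  have denE : eval (update m3 8 0 num) (Mul (var 9) (qty_den (var 4))) =
      m3 9 0 * pden (n + n + (q + l)) by rewrite /= /update /= v4 !m03.
  apply: (terminates_put bgt) => //; rewrite denE //.
  split=> //; split=> //.
  by rewrite /supply_before big_nat_recr.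
move=> m3 m3_bounded [_ [v3' m03 m32 out3] _ time3].
have lt_job := ord_lt lt_kn.
have [|time_num_small time_den_small] := tracks_small _ time3; first lia.
have job_eq : m3 2 (m3 3 0) = ord k by rewrite v3' m32.
set out_num := update m3 1 (ord k + ord k) (m3 6 0).
apply: (@terminates_seq b _ _ _ _ (fun m' => m' = out_num)).
  by apply: (terminates_put bgt); rewrite //= job_eq.
move=> _ /[swap]-> m4_bounded.
set out_den := update out_num 1 (1 + (ord k + ord k)) (m3 7 0).
apply: (@terminates_seq b _ _ _ _ (fun m' => m' = out_den)).
  have idxE : eval out_num (Add (Cst 1) (twice (Get 2 (var 3)))) = 1 + (ord k + ord k).
    by rewrite /= /out_num /update /= job_eq.
  by apply: (terminates_put bgt) => //; rewrite idxE.
move=> _ /[swap]-> m5_bounded.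
have finish4 := tracksD time3 (pt_frac lt_job).
have [|num_small den_small] := tracks_small _ finish4; first lia.
have numE : eval out_den (Add (Mul (var 6) (ptime_den (Get 2 (var 3))))
    (Mul (ptime_num (Get 2 (var 3))) (var 7))) =
    m3 6 0 * pden (ord k) + pnum (ord k) * m3 7 0.
  by rewrite /= /out_den /out_num /update /= job_eq !m03.
set num := _ + _ in numE num_small finish4.
apply: (@terminates_seq b _ _ _ _ (fun m' => m' = update out_den 6 0 num)).
  by rewrite -numE; apply: (terminates_put bgt) => //; rewrite numE.
move=> _ /[swap]-> m6_bounded.
have denE : eval (update out_den 6 0 num) (Mul (var 7) (ptime_den (Get 2 (var 3)))) =
    m3 7 0 * pden (ord k).
  by rewrite /= /out_den /out_num /update /= job_eq !m03.
apply: (terminates_put bgt) => //; rewrite denE //.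
split=> //; split=> //; split=> // i; rewrite ltnS leq_eqVlt => lt_ik.
rewrite /out_den /out_num /update /= addnC addn1.
have [lt_in|neq_i] := boolP (i == k).
  rewrite (eqP lt_in) !eqxx /=; case: eqP => [|_]; first lia.
  by case: time3.
have lt_i : i < k by move: lt_ik; rewrite (negbTE neq_i).
(* Distinct jobs have distinct output cells, and by parity numerators never meet denominators;
   earlier outputs survive. *)
have neq_ord : ord i <> ord k.
  by move/ord_inj => /(_ (ltn_trans lt_i lt_kn) lt_kn) eq_ik; rewrite eq_ik ltnn in lt_i.
do ![case: eqP => [|_]; first lia].
by have := out3 i lt_i; rewrite add1n.
Qed.

End Program.

(** * Reading the encoded instance *)

Section Encoding.
Local Open Scope nat_scope.

Lemma size_encode_family n (f : 'I_n -> rat) : size (encode_family f) = n + n.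
Proof.
rewrite -[in RHS](size_enum_ord n) /encode_family.
by elim: (enum 'I_n) => //= j s ->; rewrite addSn addnS.
Qed.

Lemma nth_encode_family n (f : 'I_n -> rat) (i : 'I_n) :
  nth 0 (encode_family f) (i + i) = `|numq (f i)| /\
  nth 0 (encode_family f) (i + i).+1 = `|denq (f i)|.
Proof.
suff nth_pairs s k : k < size s ->
    nth 0 (flatten [seq encode_rat (f j) | j <- s]) (k + k) = `|numq (f (nth i s k))| /\
    nth 0 (flatten [seq encode_rat (f j) | j <- s]) (k + k).+1 = `|denq (f (nth i s k))|.
  by have := nth_pairs (enum 'I_n) i; rewrite size_enum_ord nth_ord_enum; apply.
by elim: s k => [|j s IHs] [|k] //= /IHs; rewrite addnS.
Qed.

Lemma frac_rat (x : rat) : (0 <= x)%R -> frac `|numq x|%N `|denq x|%N x.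
Proof.
move=> x_ge0; split; first by rewrite absz_gt0 denq_eq0.
by rewrite !natr_absz !ger0_norm ?numq_ge0 ?denq_ge0 //; exact: numqE.
Qed.

(** [pre] holds the [o] fractions of the families stored before [f], which shifts the index by
    [o]. *)
Lemma frac_at_family n (f : 'I_n -> rat) (pre post : seq nat) x y o i :
    size pre = o + o -> i < n -> (forall j, 0 <= f j)%R ->
  let rd := nth 0 [:: x, y & pre ++ encode_family f ++ post] in
  frac (num_at rd (o + i)) (den_at rd (o + i)) (nat_ext f i).
Proof.
move=> size_pre lt_in f_ge0 rd.
have skip k : rd (2 + (o + o + k)) = nth 0 (encode_family f ++ post) k.
  by rewrite -[LHS]/(nth 0 (pre ++ _) _) nth_cat size_pre ltnNge leq_addr addKn.
rewrite /num_at /den_at addnACA -[3 + _]/(2 + (o + o + (i + i)).+1) -(addnS (o + o)).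
rewrite !skip !nth_cat size_encode_family !ifT; try lia.
have [-> ->] := nth_encode_family f (Ordinal lt_in).
by rewrite (nat_ext_ord f (Ordinal lt_in)); exact: frac_rat.
Qed.

(** Makes the input size an admissible value of [beta]. *)
Lemma nth_lt_input_size w i : nth 0 w i < 2 ^ input_size w.
Proof.
have [lt_i|le_i] := ltnP i (size w); last by rewrite nth_default ?expn_gt0.
apply: leq_trans (ltn_bitlen _) _; rewrite leq_exp2l // /input_size.
by rewrite (big_nth 0) big_mkord (bigD1 (Ordinal lt_i)) //= leq_addr.
Qed.

Lemma size_le_input_size w : size w <= input_size w.
Proof. by rewrite /input_size -sum1_size; apply: leq_sum. Qed.

Lemma size_encode I : size (encode I) =
  2 + ((njobs I + njobs I) + (njobs I + njobs I) +
       ((nsupp I + nsupp I) + (nsupp I + nsupp I))).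
Proof. by rewrite /= !size_cat !size_encode_family; lia. Qed.

Variables (I : instance) (abar : rat).
Hypotheses (I_valid : valid_instance I) (req_eq : forall j, req (i := I) j = abar).
Hypothesis njobs_gt0 : 0 < njobs I.

Local Notation n := (njobs I).
Local Notation q := (nsupp I).
Local Notation pnum := (num_at (nth 0 (encode I))).
Local Notation pden := (den_at (nth 0 (encode I))).

Lemma encode_ptime i : i < n -> frac (pnum i) (pden i) (nat_ext (ptime (i := I)) i).
Proof.
move=> lt_in; apply: (@frac_at_family _ _ [::] _ _ _ 0) => // j.
exact/ltW/(ptime_gt0 I_valid).
Qed.

Lemma encode_req : frac (pnum n) (pden n) abar.
Proof.
rewrite -(req_eq (Ordinal njobs_gt0)) -nat_ext_ord.
rewrite -[X in pnum X](addn0 n) -[X in pden X](addn0 n).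
apply: frac_at_family => //; [exact: size_encode_family|exact: req_ge0 I_valid].
Qed.

Lemma encode_sdate l : l < q ->
  frac (pnum (n + n + l)) (pden (n + n + l)) (nat_ext (sdate (i := I)) l).
Proof.
move=> lt_lq; rewrite /encode catA; apply: frac_at_family => // [|m].
  by rewrite size_cat !size_encode_family.
(* Dates are nonnegative because they increase from 0. *)
have [m0|m_gt0] := posnP m; first by rewrite (sdate_first I_valid).
rewrite -(sdate_first I_valid (l := Ordinal (nsupp_gt0 I_valid))) //.
exact/ltW/(sdate_incr I_valid).
Qed.

Lemma encode_sqty l : l < q ->
  frac (pnum (n + n + (q + l))) (pden (n + n + (q + l))) (nat_ext (sqty (i := I)) l).
Proof.
move=> lt_lq; rewrite /encode -[encode_family (sqty (i := I))]cats0 !catA -catA addnA.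
apply: frac_at_family => // [|m]; last exact/ltW/(sqty_gt0 I_valid).
by rewrite !size_cat !size_encode_family; lia.
Qed.

End Encoding.

(** * The polynomial time bound *)

Section Computability.
Local Open Scope nat_scope.

Lemma earlierE (rd : nat -> nat) (pt : nat -> rat) i j :
    (forall k, k < rd 0 -> frac (num_at rd k) (den_at rd k) (pt k)) ->
    i < rd 0 -> j < rd 0 ->
  earlier rd i j = (pt i < pt j)%R || (pt i == pt j) && (i < j).
Proof.
move=> pt_frac lt_i lt_j.
have ltij := frac_lt (pt_frac j lt_j) (pt_frac i lt_i).
have ltji := frac_lt (pt_frac i lt_i) (pt_frac j lt_j).
rewrite /earlier; move: ltij ltji; move: (_ * _) (_ * _) => x y.
by case: (ltgtP (pt i) (pt j)) => _ ltij ltji /=; nia.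
Qed.

(** The order comes from the program's own comparison [earlier], so the ranks computed by the
    machine are the positions in [s]. *)
Lemma exists_job_order (I : instance) : valid_instance I ->
  exists s : {perm 'I_(njobs I)}, nondecreasing_ptime s /\
    forall j : 'I_(njobs I), rank_of (nth 0 (encode I)) (s j) = j.
Proof.
move=> I_valid; set rd := nth 0 (encode I); set pt := nat_ext (ptime (i := I)).
pose lt (i j : 'I_(njobs I)) := earlier rd i j.
have ltE i j : lt i j =
    (ptime i < ptime j)%R || (ptime i == ptime j) && (i < j).
  rewrite -!(nat_ext_ord (ptime (i := I))); apply: earlierE => // k.
  exact: encode_ptime.
have [|||s [rankK incr]] := @rank_perm _ lt.
- by move=> i; rewrite ltE ltxx ltnn andbF.
- move=> j i k; rewrite !ltE => /orP[lt_ij|/andP[/eqP-> lt_ij]];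
    case/orP=> [lt_jk|/andP[/eqP eq_jk lt_jk]].
  + by rewrite (lt_trans lt_ij lt_jk).
  + by rewrite -eq_jk lt_ij.
  + by rewrite lt_jk.
  + by rewrite eq_jk eqxx (ltn_trans lt_ij lt_jk) orbT.
- move=> i j; rewrite -val_eqE !ltE /=.
  by case: (ltgtP (ptime i) (ptime j)) => //= _; rewrite neq_ltn.
exists s; split=> [i k|j].
  rewrite leq_eqVlt => /predU1P[/val_inj->//|/incr]; rewrite ltE.
  by case/orP=> [/ltW|/andP[/eqP->]].
rewrite -[RHS]rankK /rank /rank_of big_mkord -sum1_card [RHS]big_mkcond /=.
by apply: eq_bigr => i _; rewrite inE /lt; case: (earlier _ _ _).
Qed.

Lemma polynomial_time_list_schedule (R : realType) :
  polynomial_time_computable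
    (fun I : instance => valid_instance I /\ equal_requirements I)
    encode
    (fun I m => exists (s : {perm 'I_(njobs I)}) (S : schedule R I),
       [/\ nondecreasing_ptime s, list_schedule s S & outputs m S]).
Proof.
pose K := cmd_cost (Seq rank_prog list_prog).
(* The cost is at most [K * b ^ 2 * passes], where [b <= 6 * beta ^ 2] and [passes <= beta ^ 2]. *)
exists (Seq rank_prog list_prog), (36 * K), 6.
move=> I [I_valid [abar req_eq]].
set rd := nth 0 (encode I); set beta := input_size (encode I).
(* Without jobs the total requirement would be 0, but the total supply is positive. *)
have njobs_gt0 : 0 < njobs I.
  rewrite lt0n; apply/negP => /eqP n0.
  have := req_total I_valid; rewrite big_pred0; last by case=> i; rewrite {1}n0.
  apply/eqP; rewrite eq_sym gt_eqF //.
  rewrite (bigD1 (Ordinal (nsupp_gt0 I_valid))) //= ltr_wpDr ?(sqty_gt0 I_valid) //.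
  by apply: sumr_ge0 => l _; rewrite ltW ?(sqty_gt0 I_valid).
have size_le : njobs I + nsupp I + 1 <= beta.
  by apply: leq_trans (size_le_input_size _); rewrite size_encode; lia.
have beta_gt0 : 0 < beta by lia.
pose b := beta * (2 * (njobs I + nsupp I) + 4).
have rd_lt i : rd i < 2 ^ beta by exact: nth_lt_input_size.
have init_bounded : bounded b (initial (encode I)).
  move=> a i; rewrite /initial; case: ifP => _; last by rewrite expn_gt0.
  by apply: leq_trans (rd_lt i) _; rewrite leq_exp2l // leq_pmulr // addnS.
have [s [spt rankK]] := exists_job_order I_valid.
pose pt := nat_ext (ptime (i := I)).
pose sd := nat_ext (sdate (i := I)).
pose qt := nat_ext (sqty (i := I)).
(* Dominates the loop factors of both halves of the program. *)
pose passes := (njobs I + nsupp I + 1) ^ 2.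
have passes_ge u v : u <= njobs I + nsupp I -> v <= njobs I + nsupp I ->
    u.+1 * v.+1 <= passes.
  by move=> le_u le_v; rewrite /passes addn1 -mulnn leq_mul.
have [m [t [run cost _ started_m]]] : terminates b (Seq rank_prog list_prog)
    (initial (encode I)) passes
    (fun m => started rd abar pt sd qt (nat_perm s) (njobs I) (m 1)).
  pose sorted m := [/\ m 0 =1 rd & forall i, i < njobs I -> m 2 i = nat_perm s i].
  apply: (@terminates_seq b _ _ _ _ sorted) => [|m m_bounded [m0 m2]].
    apply: (terminates_weaken _ _ (terminates_rank rd_lt beta_gt0 (leqnn b) _ init_bounded _)).
    - by apply: passes_ge; rewrite ?leq_addr ?leq_addl.
    - move=> m' _ [m'0 m'2]; split=> // i lt_i.
      have := m'2 (s (Ordinal lt_i)) (ltn_ord _); rewrite rankK => ->.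
      by rewrite (nat_perm_ord s (Ordinal lt_i)).
    - move=> i k lt_i lt_k.
      rewrite -[i]/(val (Ordinal lt_i)) -[k]/(val (Ordinal lt_k)).
      rewrite -[Ordinal lt_i](permKV s) -[Ordinal lt_k](permKV s) !rankK.
      by move=> /val_inj ->.
    - by move=> i; rewrite /initial.
  apply: (terminates_weaken _ _
    (terminates_list (qt := qt) rd_lt beta_gt0 (leqnn b) _ _ _ _ _ _ m_bounded m0 m2)).
  - by apply: passes_ge; rewrite ?leq_addr ?leq_addl.
  - by move=> m' _; exact.
  - by move=> i; exact: encode_ptime.
  - exact: encode_req.
  - by move=> l; exact: encode_sdate.
  - by move=> l; exact: encode_sqty.
  - by move=> k lt_k; rewrite (nat_perm_ord s (Ordinal lt_k)).
  - move=> i k lt_i lt_k.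
    rewrite (nat_perm_ord s (Ordinal lt_i)) (nat_perm_ord s (Ordinal lt_k)).
    by move=> /val_inj /perm_inj [].
exists m, t; split=> //.
  have b_le : b <= 6 * beta ^ 2 by rewrite /b -mulnn mulnCA leq_mul2l; lia.
  have passes_le : passes <= beta ^ 2 by rewrite leq_exp2r.
  have beta6 : beta ^ 6 = beta ^ 2 * beta ^ 2 * beta ^ 2 by rewrite -!expnD.
  have := leq_mul (leqnn K) (leq_mul (leq_mul b_le b_le) passes_le).
  move: cost; rewrite -/beta beta6 -/K; move: (beta ^ 2) => x; lia.
exists s, (list_times R abar s); split=> //.
  exact: list_times_schedule.
move=> j; have := started_m (s^-1%g j) (ltn_ord _).
rewrite nat_perm_ord permKV addnn add1n => -[den_gt0 num_eq].
split; first by rewrite -lt0n.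
rewrite /list_times /list_start -ratr_nat num_eq rmorphM /= ratr_nat mulfK //.
by rewrite pnatr_eq0 -lt0n.
Qed.

End Computability.

Theorem theorem2 (R : realType) :
  polynomial_time_computable
    (fun I : instance => valid_instance I /\ equal_requirements I)
    encode
    (fun I m => exists (s : {perm 'I_(njobs I)}) (S : schedule R I),
       [/\ nondecreasing_ptime s, list_schedule s S & outputs m S])
  /\
  (forall I : instance, valid_instance I -> equal_requirements I ->
     exists OPT : R, optimum I OPT /\
       forall s : {perm 'I_(njobs I)}, nondecreasing_ptime s ->
         (exists S : schedule R I, list_schedule s S) /\
         (forall S : schedule R I, list_schedule s S ->
            feasible S /\ total_completion S <= 2 * OPT)).
Proof.
split; first exact: polynomial_time_list_schedule.
move=> I I_valid eq_req; have [abar req_eq] := eq_req.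
have [OPT opt] := optimum_exists R I_valid req_eq.
exists OPT; split=> // s spt; split.
  by exists (list_times R abar s); exact: list_times_schedule.
move=> S listS; split; first exact: list_schedule_feasible listS.
have [[S' feasS' ->] _] := opt.
exact: (spt_le_twice I_valid eq_req spt listS feasS').
Qed.
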